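(* Let $C_n^{d,\alpha}$ be a hypercycle such that $d>2\alpha$, and let $i$ be an integer with $1\le i<n$. Then for every $r$ with $1\le r\le i$, $$\beta_{i,\,id-\alpha(i-r)}(R/I(C_n^{d,\alpha}))=\frac nr\binom{i-1}{r-1}\binom{n-i-1}{r-1},$$ and $\beta_{i,j}(R/I(C_n^{d,\alpha}))=0$ for all other $j$.
   Context: A hypergraph $\mathcal H$ consists of a finite vertex set $\mathcal X(\mathcal H)$ and a finite collection $\mathcal E(\mathcal H)$ of non-empty subsets of it, called edges; it is $d$-uniform if every edge has cardinality $d$. All hypergraphs are simple: every edge has at least $2$ vertices and no edge is contained in another edge. The hypercycle $C_n^{d,\alpha}$ is the $d$-uniform hypergraph with edges $E_1,\dots,E_n$ and vertex set $\bigcup_{i=1}^n E_i$ such that (i) for any $i\ne j$, $E_i\cap E_j\neq\emptyset$ if and only if $j\equiv i-1$ or $j\equiv i+1 \pmod n$; (ii) $|E_i\cap E_{i+1}|=\alpha$ for all $1\le i\le n-1$ and $|E_1\cap E_n|=\alpha$. $R$ is the polynomial ring over a field $k$ whose variables are indexed by the vertices; for a set $F$ of vertices, $x^F=\prod_{v\in F}x_v$. The edge ideal is $I(\mathcal H)=(x^E : E\in\mathcal E(\mathcal H))$. $\beta_{i,j}(M)=\dim_k\mathrm{Tor}_i^R(M,k)_j$ are the $\mathbb N$-graded Betti numbers. A binomial coefficient $\binom ab$ is $0$ unless $0\le b\le a$. *)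

(* Defs.v *)
From HB Require Import structures.
From Stdlib Require Import ClassicalEpsilon.
From mathcomp Require Import all_boot all_order all_algebra.
From mathcomp Require Import mpoly.

Set Implicit Arguments.
Unset Strict Implicit.
Unset Printing Implicit Defensive.

Import GRing.Theory.
Local Open Scope ring_scope.

Record hypergraph := Hypergraph {
  vertices : finType;
  edges : {set {set vertices}};
  edges_card_ge2 : forall E, E \in edges -> (2 <= #|E|)%N;
  edges_antichain : forall E F, E \in edges -> F \in edges ->
    E \subset F -> E = F }.

Definition uniform (d : nat) (H : hypergraph) : Prop :=
  forall E, E \in edges H -> #|E| = d.

(* The edges E_1, ..., E_n are indexed from 0, and [j = i - 1 mod n] is written
   [j + 1 = i mod n] to avoid truncated subtraction. *)
Definition hypercycle (n d alpha : nat) (H : hypergraph) : Prop :=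
  uniform d H /\
  exists E : 'I_n -> {set vertices H},
    [/\ injective E,
        edges H = [set E i | i : 'I_n],
        \bigcup_(i < n) E i = [set: vertices H],
        forall i j : 'I_n, i != j ->
          (E i :&: E j != set0 <->
             (j.+1 = i %[mod n])%N \/ (j = i.+1 %[mod n])%N)
      & (forall i j : 'I_n, j = i.+1 :> nat -> #|E i :&: E j| = alpha) /\
        (forall i j : 'I_n, i = 0%N :> nat -> j = n.-1 :> nat ->
           #|E i :&: E j| = alpha)].

(* The variable of the vertex v is 'X_(enum_rank v). *)
Definition edge_ring (k : fieldType) (H : hypergraph) :=
  {mpoly k[#|vertices H|]}.

Definition edge_monomial (k : fieldType) (H : hypergraph)
    (F : {set vertices H}) : edge_ring k H :=
  \prod_(v in F) 'X_(enum_rank v).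

Definition edge_ideal (k : fieldType) (H : hypergraph)
    (p : edge_ring k H) : Prop :=
  exists c : {set vertices H} -> edge_ring k H,
    p = \sum_(E in edges H) c E * edge_monomial k E.

Section Betti.

Variables (k : fieldType) (m : nat).
Local Notation R := {mpoly k[m]}.

(* The map of graded modules R(-b) -> R(-a) given by multiplication by p is
   homogeneous of degree 0: p is zero or homogeneous of degree b - a. *)
Definition shift_homog (b a : nat) (p : R) : Prop :=
  forall mon : 'X_{1..m}, mon \in msupp p -> (mdeg mon + a = b)%N.

(* A sequence of graded free R-modules of finite rank
     F_i = \bigoplus_(s < rk i) R(- shift i s)
   with maps F_(i+1) -> F_i, u |-> u *m diff i, on row vectors, and
   F_0 -> R, u |-> u *m aug; the latter is a lift of an augmentation F_0 -> R/I,
   which always exists because F_0 is free. *)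
Record graded_free_seq := GradedFreeSeq {
  rk : nat -> nat;
  shift : forall i, 'I_(rk i) -> nat;
  diff : forall i, 'M[R]_(rk i.+1, rk i);
  aug : 'cV[R]_(rk 0) }.

Definition graded_maps (F : graded_free_seq) : Prop :=
  (forall i (s : 'I_(rk F i.+1)) (t : 'I_(rk F i)),
     shift_homog (shift s) (shift t) (diff F i s t)) /\
  (forall t : 'I_(rk F 0), shift_homog (shift t) 0 (aug F t 0)).

(* ... -> F_1 -> F_0 -> R/I -> 0 is exact and its maps are homogeneous. *)
Definition resolves (I : R -> Prop) (F : graded_free_seq) : Prop :=
  [/\ graded_maps F,
      forall i (u : 'rV[R]_(rk F i.+1)),
        u *m diff F i = 0 <-> exists w, u = w *m diff F i.+1,
      forall u : 'rV[R]_(rk F 0),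
        I ((u *m aug F) 0 0) <-> exists w, u = w *m diff F 0
    & forall p : R, exists u : 'rV[R]_(rk F 0), I (p - (u *m aug F) 0 0)].

Definition zero_seq : graded_free_seq :=
  @GradedFreeSeq (fun=> 0%N) (fun _ _ => 0%N) (fun=> 0) 0.

Definition resolution (I : R -> Prop) : graded_free_seq :=
  epsilon (inhabits zero_seq) (resolves I).

(* Here k = R/(x_1, ..., x_m), so that F_i (x) k = k^(rk i), with the s-th basis
   vector in degree [shift i s], and the maps are the matrices of constant
   coefficients. *)
Definition diff_k (F : graded_free_seq) i : 'M[k]_(rk F i.+1, rk F i) :=
  map_mx (mcoeff 0%MM) (diff F i).

(* Row space: the degree j component of F_i (x) k. *)
Definition component_k (F : graded_free_seq) (i j : nat) : 'M[k]_(rk F i) :=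
  diag_mx (\row_s (shift s == j)%:R).

Definition cycles_k (F : graded_free_seq) (i j : nat) : 'M[k]_(rk F i) :=
  match i with
  | 0 => component_k F 0 j
  | i'.+1 => (component_k F i'.+1 j :&: kermx (diff_k F i'))%MS
  end.

Definition boundaries_k (F : graded_free_seq) (i j : nat) :
    'M[k]_(rk F i.+1, rk F i) :=
  component_k F i.+1 j *m diff_k F i.

(* dim_k H_i(F (x) k)_j *)
Definition homology_dim (F : graded_free_seq) (i j : nat) : nat :=
  (\rank (cycles_k F i j) - \rank (boundaries_k F i j))%N.

(* beta_{i,j}(R/I) = dim_k Tor_i^R(R/I, k)_j. As usual for Tor, the value does
   not depend on the chosen resolution; one exists for homogeneous I. *)
Definition betti (I : R -> Prop) (i j : nat) : nat :=
  homology_dim (resolution I) i j.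

End Betti.

(* Main.v *)
Require Import Defs.
From HB Require Import structures.
From Stdlib Require Import ClassicalEpsilon.
From Stdlib Require Import FunctionalExtensionality PropExtensionality.
From mathcomp Require Import all_boot all_order all_algebra.
From mathcomp Require Import mpoly zify.

(** Since d > 2 alpha, every edge has a vertex lying on no other edge, so
    distinct sets S of edges have distinct lcms and the Taylor resolution of the
    edge ideal is minimal. Hence beta_(i,j) is the number of i-sets S of edges
    whose union has j vertices. If S is a proper subset of the cycle with r
    circular runs, its union has i d - alpha (i - r) vertices. Counting pairs of
    such an S and the end of one of its runs gives r N = n M, where M counts the
    S in which a fixed position ends a run; cutting the circle there turns S into
    a pair of compositions, of i and of n - i, into r positive parts. *)

Set Implicit Arguments.
Unset Strict Implicit.
Unset Printing Implicit Defensive.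

Import GRing.Theory.
Local Open Scope ring_scope.

(** * Invariance of Betti numbers under the choice of a resolution *)

(** [betti] is read off a resolution picked by [epsilon], of which only [resolves] is known. The
    Taylor resolution serves twice: it shows that a resolution exists, and comparison with it
    computes the homology. The comparison maps and homotopies must have degree 0, to respect the
    degree [j] after reduction to k, whereas exactness alone may give inhomogeneous lifts;
    projecting a lift to its degree 0 part repairs this. Exactness of the Taylor complex is checked
    in one multidegree at a time, where only a simplex remains. *)

Lemma dependent_choice (T : nat -> Type) (P : forall i, T i -> Prop)
    (Q : forall i, T i -> T i.+1 -> Prop) (x0 : T 0%N) :
  P 0%N x0 ->
  (forall i x, P i x -> exists y, P i.+1 y /\ Q i x y) ->
  exists f : forall i, T i,
    f 0%N = x0 /\ forall i, P i (f i) /\ Q i (f i) (f i.+1).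
Proof.
move=> Px0 step.
have next i (x : {x | P i x}) : {y : {y | P i.+1 y} | Q i (sval x) (sval y)}.
  case: x => x Px.
  by have [y [Py Qxy]] := constructive_indefinite_description _ (step i x Px);
    exists (exist _ y Py).
pose g := nat_rect (fun i => {x | P i x}) (exist _ x0 Px0)
  (fun i x => sval (next i x)).
exists (fun i => sval (g i)); split=> // i.
by split; [exact: svalP | exact: svalP (next i (g i))].
Qed.

(** * Homogeneous parts of polynomials and matrices *)

Section HomogeneousPart.

Variables (k : fieldType) (m : nat).
Local Notation R := {mpoly k[m]}.

(** This is the component of degree [b - a], zero if [b < a], written without truncated
    subtraction. *)
Definition hpart (b a : nat) (p : R) : R :=
  \sum_(mon <- msupp p | (mdeg mon + a == b)%N) p@_mon *: 'X_[mon].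

Lemma mcoeff_hpart b a p mon :
  (hpart b a p)@_mon = if (mdeg mon + a == b)%N then p@_mon else 0.
Proof.
rewrite raddf_sum /=.
under eq_bigr => x _ do rewrite mcoeffZ mcoeffX.
case: ifP => deg_mon; last first.
  rewrite big1 // => x deg_x; case: eqP => [eq_x|_]; last by rewrite mulr0.
  by rewrite -eq_x deg_x in deg_mon.
have [mon_p|mon_p] := boolP (mon \in msupp p).
  rewrite big_mkcond (bigD1_seq mon) ?msupp_uniq //= deg_mon eqxx mulr1.
  rewrite big1 ?addr0 // => x /negPf ->; by rewrite mulr0 if_same.
rewrite (memN_msupp_eq0 mon_p) big_seq_cond big1 // => x /andP[xp _].
case: eqP => [eq_x|_]; last by rewrite mulr0.
by rewrite -eq_x xp in mon_p.
Qed.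

Lemma shift_homogP b a (p : R) : shift_homog b a p <-> hpart b a p = p.
Proof.
split=> [hom|<- mon].
  apply/mpolyP => mon; rewrite mcoeff_hpart; case: eqP => // ne.
  have [/hom //|/memN_msupp_eq0 -> //] := boolP (mon \in msupp p).
by rewrite mcoeff_msupp mcoeff_hpart; case: (_ =P b) => //; rewrite eqxx.
Qed.

Lemma hpart_is_zmod_morphism b a : zmod_morphism (hpart b a).
Proof.
move=> p q; apply/mpolyP => mon; rewrite !(mcoeffB, mcoeff_hpart).
by case: ifP; rewrite ?subr0.
Qed.

HB.instance Definition _ b a :=
  GRing.isZmodMorphism.Build R R (hpart b a) (hpart_is_zmod_morphism b a).

Lemma hpart_id b a (p : R) : hpart b a (hpart b a p) = hpart b a p.
Proof. by apply/mpolyP => mon; rewrite !mcoeff_hpart; case: (_ == b). Qed.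

Lemma hpartM c b a (p q : R) :
  shift_homog b a q -> hpart c a (p * q) = hpart c b p * q.
Proof.
move=> hom; apply/mpolyP => mon; rewrite mcoeff_hpart !mcoeffM.
rewrite -[LHS]mulrb -mulr_natl mulr_sumr.
apply: eq_bigr => -[k1 k2] /= /eqP eq_mon.
have [/hom deg2|/memN_msupp_eq0 ->] := boolP ((k2 : 'X_{1..m}) \in msupp q);
  last by rewrite !mulr0.
rewrite mulrA mcoeff_hpart.
have -> : (mdeg mon + a = mdeg k1 + b)%N.
  by rewrite -deg2 addnA -mdegD; congr (mdeg _ + a)%N.
by case: (_ == c); rewrite ?mul1r ?mul0r.
Qed.

(* The part of [A] that is homogeneous of degree 0 for the given shifts. By
   [hmxM] the lifts of homogeneous maps can be chosen homogeneous. *)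
Definition hmx p q (sr : 'I_p -> nat) (sc : 'I_q -> nat) (A : 'M[R]_(p, q)) :=
  \matrix_(s, t) hpart (sr s) (sc t) (A s t).

Lemma hmxP p q (sr : 'I_p -> nat) (sc : 'I_q -> nat) (A : 'M[R]_(p, q)) :
  (forall s t, shift_homog (sr s) (sc t) (A s t)) <-> hmx sr sc A = A.
Proof.
split=> [hom|eqA s t].
  by apply/matrixP => s t; rewrite mxE; apply/shift_homogP.
by apply/shift_homogP; move/matrixP/(_ s t): eqA; rewrite mxE.
Qed.

Lemma hmxB p q (sr : 'I_p -> nat) (sc : 'I_q -> nat) :
  {morph hmx sr sc : A B / A - B}.
Proof. by move=> A B; apply/matrixP => s t; rewrite !mxE raddfB. Qed.

Lemma hmx_id p q (sr : 'I_p -> nat) (sc : 'I_q -> nat) (A : 'M[R]_(p, q)) :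
  hmx sr sc (hmx sr sc A) = hmx sr sc A.
Proof. by apply/matrixP => s t; rewrite !mxE hpart_id. Qed.

Lemma hmxM p q r (sp : 'I_p -> nat) (sq : 'I_q -> nat) (sr : 'I_r -> nat)
    (A : 'M[R]_(p, q)) (B : 'M[R]_(q, r)) :
  hmx sq sr B = B -> hmx sp sr (A *m B) = hmx sp sq A *m B.
Proof.
move=> /hmxP homB; apply/matrixP => s t; rewrite !mxE raddf_sum.
by apply: eq_bigr => l _; rewrite mxE; apply: hpartM.
Qed.

Lemma hmx1 p (sp : 'I_p -> nat) : hmx sp sp (1%:M : 'M[R]_p) = 1%:M.
Proof.
apply/hmxP => s t mon; rewrite mxE mcoeff_msupp.
case: (s =P t) => [->|_]; last by rewrite mcoeff0 eqxx.
by rewrite mcoeff1; case: (mon =P _) => [->|_]; rewrite ?mdeg0 ?eqxx.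
Qed.

Lemma hmx_mul p q r (sp : 'I_p -> nat) (sq : 'I_q -> nat) (sr : 'I_r -> nat)
    (A : 'M[R]_(p, q)) (B : 'M[R]_(q, r)) :
  hmx sp sq A = A -> hmx sq sr B = B -> hmx sp sr (A *m B) = A *m B.
Proof. by move=> homA homB; rewrite (hmxM _ _ homB) homA. Qed.

Definition homog_ideal (I : R -> Prop) : Prop :=
  [/\ I 0, forall p q, I p -> I q -> I (p + q),
      forall c p, I p -> I (c * p)
    & forall b a p, I p -> I (hpart b a p)].

Lemma homog_ideal_sum (I : R -> Prop) (T : finType) (F : T -> R) :
  homog_ideal I -> (forall t, I (F t)) -> I (\sum_t F t).
Proof. by case=> I0 ID _ _ IF; apply: big_ind. Qed.

End HomogeneousPart.

Section Lifting.

Variables (k : fieldType) (m : nat).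
Local Notation R := {mpoly k[m]}.

Lemma mulmx_row_exists p q r (A : 'M[R]_(p, r)) (D : 'M[R]_(q, r)) :
  (forall s, exists w, row s A = w *m D) -> exists W, A = W *m D.
Proof.
move=> /fin_all_exists [f eq_f]; exists (\matrix_s f s).
by apply/row_matrixP => s; rewrite row_mul rowK.
Qed.

Variables (I : R -> Prop) (F : graded_free_seq k m).
Hypotheses (homI : homog_ideal I) (resF : resolves I F).

Lemma hmx_diff i :
  hmx (@shift _ _ F i.+1) (@shift _ _ F i) (diff F i) = diff F i.
Proof. by case: resF => -[hom _] _ _ _; apply/hmxP. Qed.

Lemma hmx_aug : hmx (@shift _ _ F 0) (fun=> 0%N) (aug F) = aug F.
Proof.
by case: resF => -[_ hom] _ _ _; apply/hmxP => s t; rewrite (ord1 t).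
Qed.

Lemma diff_diff i : diff F i.+1 *m diff F i = 0.
Proof.
case: resF => _ ex _ _; apply/row_matrixP => s; rewrite row_mul row0.
by apply/ex; exists (delta_mx 0 s); rewrite rowE.
Qed.

Lemma diff_aug s : I ((diff F 0 *m aug F) s 0).
Proof.
case: resF => _ _ ex _.
have /ex : exists w, row s (diff F 0) = w *m diff F 0.
  by exists (delta_mx 0 s); rewrite rowE.
by rewrite -row_mul mxE.
Qed.

(** Exactness, applied row by row, gives some lift; its degree 0 part is still a lift, since
    [diff F i.+1] is homogeneous and [A] is its own degree 0 part. *)
Lemma lift_diff i p (sp : 'I_p -> nat) (A : 'M[R]_(p, rk F i.+1)) :
  A *m diff F i = 0 -> hmx sp (@shift _ _ F i.+1) A = A ->
  exists W, hmx sp (@shift _ _ F i.+2) W = W /\ A = W *m diff F i.+1.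
Proof.
case: resF => _ ex _ _ A0 homA.
have [|W eqA] := @mulmx_row_exists _ _ _ A (diff F i.+1).
  by move=> s; apply/ex; rewrite -row_mul A0 row0.
exists (hmx sp (@shift _ _ F i.+2) W); split; first exact: hmx_id.
by rewrite -(hmxM _ _ (hmx_diff _)) -eqA.
Qed.

Lemma lift_aug p (sp : 'I_p -> nat) (A : 'M[R]_(p, rk F 0)) :
  (forall s, I ((A *m aug F) s 0)) -> hmx sp (@shift _ _ F 0) A = A ->
  exists W, hmx sp (@shift _ _ F 1) W = W /\ A = W *m diff F 0.
Proof.
case: resF => _ _ ex _ A0 homA.
have [|W eqA] := @mulmx_row_exists _ _ _ A (diff F 0).
  by move=> s; apply/ex; rewrite -row_mul mxE.
exists (hmx sp (@shift _ _ F 1) W); split; first exact: hmx_id.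
by rewrite -(hmxM _ _ (hmx_diff _)) -eqA.
Qed.

Lemma lift_quotient p (sp : 'I_p -> nat) (b : 'cV[R]_p) :
  hmx sp (fun=> 0%N) b = b ->
  exists W, hmx sp (@shift _ _ F 0) W = W /\
    forall s, I ((b - W *m aug F) s 0).
Proof.
case: resF => _ _ _ surj homb.
have /fin_all_exists [f If] : forall s, exists u : 'rV[R]_(rk F 0),
    I (b s 0 - (u *m aug F) 0 0) by move=> s; apply: surj.
exists (hmx sp (@shift _ _ F 0) (\matrix_s f s)); split; first exact: hmx_id.
move=> s; rewrite -(hmxM _ _ hmx_aug) -homb -hmxB mxE.
case: homI => _ _ _; apply.
have := If s; congr I; rewrite [RHS]mxE; congr (_ + _).
rewrite [RHS]mxE; congr (- _).
by rewrite !mxE; apply: eq_bigr => l _; rewrite mxE.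
Qed.

End Lifting.

Section Comparison.

Variables (k : fieldType) (m : nat).
Local Notation R := {mpoly k[m]}.

(** The last condition holds only modulo I, because [aug] is a lift to R of the augmentation onto
    R/I. *)
Definition chain_map (I : R -> Prop) (F G : graded_free_seq k m)
    (phi : forall i, 'M[R]_(rk F i, rk G i)) : Prop :=
  [/\ forall i, hmx (@shift _ _ F i) (@shift _ _ G i) (phi i) = phi i,
      forall i, diff F i *m phi i = phi i.+1 *m diff G i
    & forall s, I ((aug F - phi 0%N *m aug G) s 0)].

Variable I : R -> Prop.
Hypothesis homI : homog_ideal I.

Lemma chain_map_exists F G :
  resolves I F -> resolves I G -> exists phi, @chain_map I F G phi.
Proof.
move=> resF resG.
pose hom i (A : 'M[R]_(rk F i, rk G i)) :=
  hmx (@shift _ _ F i) (@shift _ _ G i) A = A.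
(* [P] looks one step ahead: [W] becomes the next map, and its square with [A] shows that what has
   to be lifted after it is a cycle. *)
pose P i A := hom i A /\ exists W,
  hmx (@shift _ _ F i.+1) (@shift _ _ G i.+1) W = W /\
  diff F i *m A = W *m diff G i.
have lift0 A : hom 0%N A -> (forall s, I ((aug F - A *m aug G) s 0)) -> P 0%N A.
  move=> homA IA; split=> //; apply: (lift_aug resG); last first.
    exact: hmx_mul (hmx_diff resF 0) homA.
  move=> s; case: homI => I0 ID IM _.
  have -> : diff F 0 *m A *m aug G
      = diff F 0 *m aug F + (-1 *: diff F 0) *m (aug F - A *m aug G).
    by rewrite scaleN1r mulNmx mulmxBr opprB addrCA subrr addr0 mulmxA.
  rewrite mxE; apply: ID; first exact: (diff_aug resF).
  rewrite mxE; apply: homog_ideal_sum => // t; exact: IM.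
have [A [homA IA]] := lift_quotient homI resG (hmx_aug resF).
have [|i B [homB [W [homW eqW]]]|phi [phi0 phiP]] := @dependent_choice _ P
  (fun i A B => diff F i *m A = B *m diff G i) A.
- exact: lift0.
- exists W; split=> //; split=> //.
  apply: (lift_diff resG); last exact: hmx_mul (hmx_diff resF _) homW.
  by rewrite -mulmxA -eqW mulmxA (diff_diff resF) mul0mx.
exists phi; split=> [i|i|]; last by rewrite phi0.
- by have [[]] := phiP i.
- by have [] := phiP i.
Qed.

Lemma chain_homotopy F (theta : forall i, 'M[R]_(rk F i)) :
  resolves I F -> chain_map I theta ->
  exists h : forall i, 'M[R]_(rk F i, rk F i.+1), forall i,
    hmx (@shift _ _ F i) (@shift _ _ F i.+1) (h i) = h i /\
    theta i.+1 - 1%:M = diff F i *m h i + h i.+1 *m diff F i.+1.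
Proof.
move=> resF [hom_th comm_th aug_th].
(* The identity says that [diff F i] kills [theta i.+1 - 1%:M - diff F i *m A], whose lift along
   [diff F i.+1] is the next homotopy. *)
pose P i (A : 'M[R]_(rk F i, rk F i.+1)) :=
  hmx (@shift _ _ F i) (@shift _ _ F i.+1) A = A /\
  diff F i *m (theta i - 1%:M) = diff F i *m A *m diff F i.
have hom_th1 i : hmx (@shift _ _ F i) (@shift _ _ F i) (theta i - 1%:M)
    = theta i - 1%:M by rewrite hmxB hmx1 hom_th.
have [|A [homA eqA]] := lift_aug resF _ (hom_th1 0%N).
  move=> s; case: homI => _ _ IM _.
  have -> : (theta 0%N - 1%:M) *m aug F = -1 *: (aug F - theta 0%N *m aug F).
    by rewrite scaleN1r opprB mulmxBl mul1mx.
  by rewrite mxE; apply: IM.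
have [|i B [homB eqB]|h [_ hP]] := @dependent_choice _ P
  (fun i A B => theta i.+1 - 1%:M = diff F i *m A + B *m diff F i.+1) A.
- by split=> //; rewrite eqA mulmxA.
- have [||W [homW eqW]] := @lift_diff _ _ _ _ resF i _ (@shift _ _ F i.+1)
    (theta i.+1 - 1%:M - diff F i *m B).
  + by rewrite mulmxBl -eqB mulmxBl mulmxBr mul1mx mulmx1 comm_th subrr.
  + by rewrite hmxB hom_th1 (hmx_mul (hmx_diff resF i) homB).
  exists W; split; last by rewrite -eqW addrCA subrr addr0.
  split=> //; rewrite -mulmxA -eqW [RHS]mulmxBr mulmxA (diff_diff resF).
  by rewrite mul0mx subr0.
by exists h => i; have [[homh _] eqh] := hP i.
Qed.

Lemma chain_map_comp F G phi psi :
  @chain_map I F G phi -> @chain_map I G F psi ->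
  @chain_map I F F (fun i => phi i *m psi i).
Proof.
move=> [hom_phi comm_phi aug_phi] [hom_psi comm_psi aug_psi]; split=> [i|i|s].
- exact: hmx_mul.
- by rewrite mulmxA comm_phi -!mulmxA comm_psi.
have -> : aug F - phi 0%N *m psi 0%N *m aug F
    = (aug F - phi 0%N *m aug G) + phi 0%N *m (aug G - psi 0%N *m aug F).
  by rewrite mulmxBr mulmxA addrA subrK.
case: (homI) => _ ID IM _; rewrite mxE; apply: ID => //.
by rewrite mxE; apply: homog_ideal_sum => // t; apply: IM.
Qed.

End Comparison.

(** A complement [W] of [Z :&: B] in [Z] is mapped injectively by [f], and its image meets [B'] only
    in 0; the image and [B'] both fit into [Z']. *)
Lemma rank_subquotient_le (K : fieldType) a b c d n p
    (Z : 'M[K]_(a, n)) (B : 'M[K]_(b, n))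
    (Z' : 'M[K]_(c, p)) (B' : 'M[K]_(d, p)) (f : 'M[K]_(n, p)) :
  (Z *m f <= Z')%MS -> (B' <= Z')%MS ->
  (forall u : 'rV_n, (u <= Z)%MS -> (u *m f <= B')%MS -> (u <= B)%MS) ->
  (\rank Z - \rank B <= \rank Z' - \rank B')%N.
Proof.
move=> ZfZ' B'Z' injf.
set W := (Z :\: B)%MS.
have W0 (u : 'rV_n) : (u <= W)%MS -> (u *m f <= B')%MS -> u = 0.
  move=> uW ufB'; apply/eqP; rewrite -submx0 -(capmx_diff Z B) sub_capmx uW /=.
  by apply: injf => //; apply: submx_trans uW (diffmxSl _ _).
have rankW : \rank (W *m f) = \rank W.
  rewrite -(mxrank_mul_ker W f); set K0 := (W :&: _)%MS.
  suff -> : K0 = 0 by rewrite mxrank0 addn0.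
  apply/row_matrixP => s; rewrite row0; apply: W0.
    exact: submx_trans (row_sub _ _) (capmxSl _ _).
  have /sub_kermxP -> : (row s K0 <= kermx f)%MS.
    exact: submx_trans (row_sub _ _) (capmxSr _ _).
  exact: sub0mx.
have cap0 : (W *m f :&: B')%MS = 0.
  apply/row_matrixP => s; rewrite row0.
  have := row_sub s (W *m f :&: B')%MS.
  rewrite sub_capmx => /andP[/submxP[w ->] wB'].
  by rewrite mulmxA (W0 (w *m W)) ?mul0mx ?submxMl // -mulmxA.
have sum_le : (W *m f + B' <= Z')%MS.
  rewrite addsmx_sub B'Z' andbT; apply: submx_trans ZfZ'.
  exact: submxMr (diffmxSl _ _).
have := mxrankS sum_le; rewrite (mxrank_disjoint_sum cap0) rankW.
have := mxrank_cap_compl Z B; rewrite -/W => rankZ.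
have := mxrankS (capmxSr Z B).
lia.
Qed.

(** * Homology after reduction modulo the variables *)

Section HomologyOfTensor.

Variables (k : fieldType) (m : nat).
Local Notation R := {mpoly k[m]}.
Local Notation modm := (map_mx (mcoeff 0%MM)).

(** An entry of [A] with nonzero constant term joins basis vectors of equal degree. *)
Lemma component_k_comm (F G : graded_free_seq k m) i l
    (A : 'M[R]_(rk F i, rk G l)) j :
  hmx (@shift _ _ F i) (@shift _ _ G l) A = A ->
  component_k F i j *m modm A
    = modm A *m component_k G l j.
Proof.
move=> /hmxP homA; apply/matrixP => s t.
rewrite mul_diag_mx mul_mx_diag !mxE mulrC.
have [/homA|/memN_msupp_eq0 ->] := boolP (0%MM \in msupp (A s t)).
  by rewrite mdeg0 add0n => ->.
by rewrite !mul0r.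
Qed.

Lemma component_k_idem (F : graded_free_seq k m) i j :
  component_k F i j *m component_k F i j = component_k F i j.
Proof.
apply/matrixP => s t; rewrite mul_diag_mx !mxE.
by case: (_ == j); rewrite ?mul1r ?mul0r ?mul0rn.
Qed.

Lemma sub_component_k (F : graded_free_seq k m) i j p (u : 'M_(p, rk F i)) :
  (u <= component_k F i j)%MS -> u = u *m component_k F i j.
Proof. by move=> /submxP[w ->]; rewrite -mulmxA component_k_idem. Qed.

Variable I : R -> Prop.
Hypothesis homI : homog_ideal I.

(** [phi] is injective on homology over k, with left inverse induced by [psi]. *)
Lemma homology_dim_le (F G : graded_free_seq k m) i j :
  resolves I F -> resolves I G ->
  (homology_dim F i.+1 j <= homology_dim G i.+1 j)%N.
Proof.
move=> resF resG.
have [phi mapFG] := chain_map_exists homI resF resG.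
have [psi mapGF] := chain_map_exists homI resG resF.
have [h hP] := chain_homotopy homI resF (chain_map_comp homI mapFG mapGF).
have [hom_phi comm_phi _] := mapFG; have [hom_psi comm_psi _] := mapGF.
have [hom_h htpy] := hP i; have [hom_h' _] := hP i.+1.
apply: (@rank_subquotient_le _ _ _ _ _ _ _ _ _ _ _ (modm (phi i.+1))) => /=.
- rewrite sub_capmx; apply/andP; split.
    apply: submx_trans (submxMr _ (capmxSl _ _)) _.
    by rewrite component_k_comm // submxMl.
  apply/sub_kermxP; rewrite -mulmxA -map_mxM -comm_phi map_mxM mulmxA.
  by rewrite (sub_kermxP (capmxSr _ _)) mul0mx.
- rewrite sub_capmx; apply/andP; split.
    by rewrite /boundaries_k component_k_comm ?submxMl // (hmx_diff resG).
  apply/sub_kermxP; rewrite -mulmxA -map_mxM (diff_diff resG).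
  by rewrite map_mx0 mulmx0.
- move=> u; rewrite sub_capmx => /andP[/sub_component_k uD /sub_kermxP u0].
  move=> /submxP[w eq_uphi].
  (* The homotopy identity at the cycle [u], whose [diff F i] term vanishes. Both remaining terms
     are boundaries, the first because [u *m modm (phi i.+1)] is one in G. *)
  have eq_u : u = u *m modm (phi i.+1) *m modm (psi i.+1)
      - u *m modm (h i.+1) *m diff_k F i.+1.
    have := congr1 (fun A => u *m modm A) htpy.
    rewrite map_mxB map_mxD map_mx1 !map_mxM mulmxBr mulmxDr mulmx1.
    rewrite !mulmxA -/(diff_k F i) u0 !mul0mx add0r => <-.
    by rewrite opprB addrCA subrr addr0.
  rewrite eq_u; apply: addmx_sub; last first.
    rewrite eqmx_opp [in u *m _]uD -(mulmxA u) component_k_comm //.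
    by rewrite -!mulmxA mulmxA submxMl.
  rewrite eq_uphi -!mulmxA -map_mxM comm_psi map_mxM /boundaries_k.
  rewrite (mulmxA (component_k _ _ _)) component_k_comm //.
  by rewrite -mulmxA mulmxA submxMl.
Qed.

Lemma homology_dim_resolves (F G : graded_free_seq k m) i j :
  resolves I F -> resolves I G ->
  homology_dim F i.+1 j = homology_dim G i.+1 j.
Proof. by move=> resF resG; apply/eqP; rewrite eqn_leq !homology_dim_le. Qed.

Lemma betti_resolves (F : graded_free_seq k m) i j :
  resolves I F -> betti I i.+1 j = homology_dim F i.+1 j.
Proof.
move=> resF; apply: homology_dim_resolves => //.
by apply: epsilon_spec; exists F.
Qed.

End HomologyOfTensor.

(** * The Taylor resolution of a monomial ideal *)

Section SimplexChains.

Variables (n : nat).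

(** [(-1) ^+ pos l S] is the incidence sign of the facet [S :\ l] of [S]. *)
Definition pos (l : 'I_n) (S : {set 'I_n}) : nat :=
  #|[set x in S | (x < l)%N]|.

Lemma posD1 a b (S : {set 'I_n}) :
  b \in S -> pos a S = ((b < a) + pos a (S :\ b))%N.
Proof.
move=> bS; rewrite /pos (cardsD1 b) inE bS /=; congr (_ + _)%N.
by apply: eq_card => x; rewrite !inE andbA.
Qed.

(** Only the larger of [a] and [b] loses a smaller element when the other is removed. Hence removing
    both in either order gives opposite signs. *)
Lemma pos_swap a b (S : {set 'I_n}) : a \in S -> b \in S -> a != b ->
  (pos a S + pos b S = (pos a (S :\ b) + pos b (S :\ a)).+1)%N.
Proof.
move=> aS bS neq; rewrite (posD1 a bS) (posD1 b aS).
by have := neq; rewrite -val_eqE /=; case: ltngtP => //; lia.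
Qed.

(** Terms below the diagonal cancel those above it. There is no division by 2, so characteristic 2
    is covered. *)
Lemma sum_antisym (V : zmodType) (F : 'I_n -> 'I_n -> V) :
  (forall a, F a a = 0) -> (forall a b, F a b = - F b a) ->
  \sum_a \sum_b F a b = 0.
Proof.
move=> diag anti.
have split_row a : \sum_b F a b =
    \sum_(b : 'I_n | (a < b)%N) F a b + \sum_(b : 'I_n | (b < a)%N) F a b.
  rewrite (bigID (fun b : 'I_n => (a < b)%N)) /=; congr (_ + _).
  rewrite (bigID (fun b : 'I_n => b == a)) /= big1 ?add0r.
    by apply: eq_bigl => b; rewrite -val_eqE /=; lia.
  by move=> b /andP[_ /eqP ->].
under eq_bigr => a _ do rewrite split_row.
rewrite big_split /= addrC.
rewrite (exchange_big_dep predT) //= -big_split big1 //= => a _.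
by rewrite -big_split big1 //= => b _; rewrite anti addNr.
Qed.

Variable K : comPzRingType.

(** The simplicial boundary in coefficients. The empty face is included, so this is the augmented
    complex. *)
Definition bd (c : {set 'I_n} -> K) (T : {set 'I_n}) : K :=
  \sum_(l | l \notin T) (-1) ^+ pos l (l |: T) * c (l |: T).

Lemma bd_bd c T : bd (bd c) T = 0.
Proof.
pose F a b : K := if [&& a \notin T, b \notin T & a != b] then
  (-1) ^+ pos a (a |: T) * ((-1) ^+ pos b (b |: (a |: T)) * c (b |: (a |: T)))
  else 0.
rewrite -[RHS](@sum_antisym _ F).
- rewrite /bd big_mkcond; apply: eq_bigr => a _; rewrite /F.
  case: ifP => aT /=; last by rewrite big1.
  rewrite mulr_sumr [LHS]big_mkcond; apply: eq_bigr => b _.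
  by rewrite !inE negb_or [a == b]eq_sym andbC.
- by move=> a; rewrite /F eqxx !andbF.
- move=> a b; rewrite /F [b == a]eq_sym andbCA.
  case: ifP; last by rewrite oppr0.
  case/and3P => bT aT ab; rewrite !mulrA -!exprD -mulNr [b |: (a |: T)]setUCA.
  set U := a |: (b |: T); congr (_ * _); rewrite -signr_odd.
  have [aU bU] : a \in U /\ b \in U by rewrite !inE !eqxx !orbT.
  have := pos_swap aU bU ab.
  have -> : U :\ a = b |: T.
    by rewrite /U setU1K // !inE negb_or ab aT.
  have -> : U :\ b = a |: T.
    by rewrite /U setUCA setU1K // !inE negb_or eq_sym ab bT.
  move=> /(congr1 odd); rewrite /= !oddD => eq_odd.
  suff -> : odd (pos a (a |: T)) (+) odd (pos b U)
      = ~~ odd (pos b (b |: T) + pos a U) by rewrite signrN signr_odd.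
  by move: eq_odd; rewrite oddD; do 4 case: (odd _).
Qed.

Definition cone (a : 'I_n) (c : {set 'I_n} -> K) (S : {set 'I_n}) : K :=
  if a \in S then (-1) ^+ pos a S * c (S :\ a) else 0.

(** If [a] is not in [T], only [l = a] contributes to the boundary of the cone. Otherwise [l = a] in
    the second summand gives [c T], and its other terms cancel the first summand by [pos_swap]. *)
Lemma bd_cone a c T : bd (cone a c) T + cone a (bd c) T = c T.
Proof.
have sqr x : (-1) ^+ x * (-1) ^+ x = 1 :> K by rewrite -expr2 sqrr_sign.
rewrite /cone /bd; have [aT|aT] := boolP (a \in T); last first.
  rewrite addr0 (bigD1 a) //= big1 ?addr0.
    by rewrite setU11 mulrA sqr mul1r setU1K.
  by move=> l /andP[_ la]; rewrite !inE (negPf aT) eq_sym (negPf la) mulr0.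
rewrite [X in _ + _ * X](bigD1 a) /= ?setD11 // setD1K //.
rewrite mulrDr [_ * (_ * c T)]mulrA sqr mul1r addrCA mulr_sumr.
rewrite [X in _ + (_ + X)](eq_bigl (fun l => l \notin T)); last first.
  by move=> l; rewrite !inE; case: eqP => [->|_] /=; rewrite ?aT ?andbF ?andbT.
rewrite -big_split big1 ?addr0 //= => l lT.
have la : a != l by apply: contraNneq lT => <-.
set U := l |: T; have [aU lU] : a \in U /\ l \in U by rewrite !inE eqxx aT orbT.
rewrite aU.
have -> : l |: T :\ a = U :\ a.
  apply/setP => x; rewrite !inE.
  by case: (x =P l) => [->|]; rewrite // eq_sym la.
have := pos_swap aU lU la; have -> : U :\ l = T by rewrite setU1K.
move=> eq_pos; rewrite !mulrA -mulrDl -!exprD.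
by rewrite [(pos l U + _)%N]addnC eq_pos exprS mulN1r addNr mul0r.
Qed.

End SimplexChains.

(** * The Taylor differential, one multidegree at a time *)

Section TaylorMaps.

Variables (k : fieldType) (m n : nat) (e : 'I_n -> 'X_{1..m}).
Local Notation R := {mpoly k[m]}.
Implicit Types (S T : {set 'I_n}) (f g : {set 'I_n} -> R) (w : 'X_{1..m}).

Definition lcm_mon S : 'X_{1..m} := [multinom (\max_(l in S) e l v)%N | v < m].

Lemma lcm_monP S w :
  reflect (forall l, l \in S -> (e l <= w)%MM) (lcm_mon S <= w)%MM.
Proof.
apply: (iffP mnm_lepP) => [le_w l lS|le_w v].
  apply/mnm_lepP => v; apply: leq_trans (le_w v).
  by rewrite mnmE; apply: leq_bigmax_cond.
by rewrite mnmE; apply/bigmax_leqP => l /le_w /mnm_lepP.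
Qed.

Lemma lcm_mon_sub S T : S \subset T -> (lcm_mon S <= lcm_mon T)%MM.
Proof.
move=> /subsetP sST; apply/lcm_monP => l /sST lT.
exact: (lcm_monP _ _ (lepm_refl _)).
Qed.

Lemma lcm_mon0 : lcm_mon set0 = 0%MM.
Proof. by apply/mnmP => v; rewrite mnmE big_set0 mnm0E. Qed.

Lemma lcm_mon1 l : lcm_mon [set l] = e l.
Proof. by apply/mnmP => v; rewrite mnmE big_set1. Qed.

Lemma mcoeffMX_le (p : R) v w :
  (p * 'X_[v])@_w = if (v <= w)%MM then p@_(w - v) else 0.
Proof.
case: ifP => [vw|/negbT nvw]; first by rewrite -{1}(submK vw) addmC mcoeffMX.
apply: memN_msupp_eq0; apply: contra nvw; rewrite (perm_mem (msuppMX p v)).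
by case/mapP => u _ ->; rewrite lem_addr.
Qed.

(** No cardinality is fixed, so that one exactness statement serves all homological degrees. *)
Definition tmap f T : R := \sum_(l | l \notin T)
  (-1) ^+ pos l (l |: T) *: (f (l |: T) * 'X_[lcm_mon (l |: T) - lcm_mon T]).

(* The component of the chain [f] in the multidegree [w], a chain of the full
   simplex supported on the faces whose lcm divides [w]. *)
Definition strand w f S : k :=
  if (lcm_mon S <= w)%MM then (f S)@_(w - lcm_mon S) else 0.

(** The monomial factor of each term only moves the exponent at which its coefficient is read, from
    [w - lcm_mon T] to [w - lcm_mon (l |: T)]; the signs remain. *)
Lemma strand_tmap w f T : strand w (tmap f) T = bd (strand w f) T.
Proof.
rewrite /strand /bd; case: ifP => [Tw|/negbT Tw]; last first.
  rewrite big1 // => l _; rewrite ifF ?mulr0 //; apply: contraNF Tw.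
  by apply: lepm_trans; apply/lcm_mon_sub/subsetUr.
rewrite raddf_sum; apply: eq_bigr => l lT /=.
rewrite mcoeffZ mcoeffMX_le; congr (_ * _).
have sub : (lcm_mon T <= lcm_mon (l |: T))%MM by apply/lcm_mon_sub/subsetUr.
have -> : (lcm_mon (l |: T) - lcm_mon T <= w - lcm_mon T)%MM
    = (lcm_mon (l |: T) <= w)%MM.
  apply/mnm_lepP/mnm_lepP => le_v v; move/mnm_lepP/(_ v): sub (le_v v);
    move/mnm_lepP/(_ v): Tw; rewrite !mnmBE; lia.
case: ifP => // lw; congr (_@__); apply/mnmP => v.
move/mnm_lepP/(_ v): sub; move/mnm_lepP/(_ v): lw; rewrite !mnmBE; lia.
Qed.

Lemma strandP f g S : (forall w, strand w f S = strand w g S) -> f S = g S.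
Proof.
move=> eq_fg; apply/mpolyP => v; move: (eq_fg (v + lcm_mon S)%MM).
by rewrite /strand lem_addl addmK.
Qed.

Lemma tmap_tmap f T : tmap (tmap f) T = 0.
Proof.
rewrite (@strandP (tmap (tmap f)) (fun=> 0) T) // => w.
rewrite strand_tmap [RHS]/strand mcoeff0 if_same -[RHS](bd_bd (strand w f) T).
by apply: eq_bigr => l _; rewrite strand_tmap.
Qed.

(** The faces whose lcm divides [w] form the full simplex on the generators dividing [w]. If there
    are none, only the empty face is left, and the second hypothesis kills its coefficient. *)
Lemma tmap_exact f :
  (forall T, tmap f T = 0) ->
  (forall w, (forall l, ~~ (e l <= w)%MM) -> (f set0)@_w = 0) ->
  exists g, forall T, tmap g T = f T.
Proof.
move=> f0 f_set0.
(* In each multidegree [w], contract onto a generator dividing [w]. *)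
pose c w S : k := if [pick l | (e l <= w)%MM] is Some a
  then cone a (strand w f) S else 0.
have c_le w S : c w S != 0 -> exists2 a, a \in S &
    [/\ (e a <= w)%MM, (lcm_mon (S :\ a) <= w)%MM &
         (w - lcm_mon (S :\ a))%MM \in msupp (f (S :\ a))].
  rewrite /c; case: pickP => [a aw|_]; last by rewrite eqxx.
  rewrite /cone; case: ifP => aS; last by rewrite eqxx.
  rewrite /strand; case: ifP => Sw; last by rewrite mulr0 eqxx.
  rewrite mulf_eq0 negb_or => /andP[_ fS].
  by exists a => //; rewrite mcoeff_msupp.
(* A nonzero [c (v + lcm_mon S) S] comes from a monomial of some [f (S :\ a)] of degree at least
   [mdeg v]. So [B] bounds all relevant [v], and [g S] is a polynomial. *)
pose B := (\max_S msize (f S))%N.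
pose g S : R := \sum_(v : 'X_{1..m < B}) c (v + lcm_mon S)%MM S *: 'X_[v].
have gE v S : (g S)@_v = c (v + lcm_mon S)%MM S.
  have [vB|vB] := ltnP (mdeg v) B.
    exact: (mcoeff_mpoly (fun v => c (v + lcm_mon S)%MM S) vB).
  rewrite raddf_sum big1 => [|[u uB] _ /=]; last first.
    rewrite mcoeffZ mcoeffX; case: eqP => [eq_u|_]; last by rewrite mulr0.
    by rewrite -eq_u leqNgt uB in vB.
  apply/esym/eqP; apply: contraLR vB => /c_le [a aS [_ _ supp]].
  rewrite -ltnNge.
  apply: leq_trans (leq_bigmax (F := fun S => msize (f S)) (S :\ a)).
  apply: leq_ltn_trans (msize_mdeg_lt supp).
  rewrite -addmBA ?lcm_mon_sub ?subD1set //.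
  by rewrite mdegD leq_addr.
exists g => T; apply: strandP => w; rewrite strand_tmap.
have strand_g S : strand w g S = c w S.
  rewrite /strand gE; case: ifP => [Sw|/negbT Sw]; first by rewrite submK.
  apply/esym/eqP; apply: contraNT Sw => /c_le [a aS [aw /lcm_monP Saw _]].
  apply/lcm_monP => l lS; have [->//|la] := eqVneq l a.
  by apply: Saw; rewrite !inE la.
rewrite /bd (eq_bigr (fun l => (-1) ^+ pos l (l |: T) * c w (l |: T)));
  last by move=> l _; rewrite strand_g.
rewrite /c; case: pickP => [a aw|no_a].
  rewrite -[RHS](bd_cone a) -[LHS]addr0; congr (_ + _).
  rewrite /cone; case: ifP => // _.
  by rewrite -strand_tmap /strand f0 mcoeff0 if_same mulr0.
rewrite big1 => [|l _]; last by rewrite mulr0.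
rewrite /strand; have [->|[l lT]] := set_0Vmem T.
  by rewrite lcm_mon0 subm0 f_set0 ?if_same // => l; rewrite no_a.
by case: ifP => // /lcm_monP/(_ l lT); rewrite no_a.
Qed.

End TaylorMaps.

Section TaylorResolution.

Variables (k : fieldType) (m n : nat) (e : 'I_n -> 'X_{1..m}).
Local Notation R := {mpoly k[m]}.
Implicit Types (S T : {set 'I_n}) (f g : {set 'I_n} -> R).

Definition monomial_ideal (p : R) : Prop :=
  exists c : 'I_n -> R, p = \sum_l c l * 'X_[e l].

Lemma shift_homogZX b a (c : k) (v : 'X_{1..m}) :
  (mdeg v + a = b)%N -> shift_homog b a (c *: 'X_[v]).
Proof.
move=> eq_b w; rewrite mcoeff_msupp mcoeffZ mcoeffX.
by case: (v =P w) => [<-|]; rewrite ?mulr0 ?eqxx.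
Qed.

Lemma homog_monomial_ideal : homog_ideal monomial_ideal.
Proof.
split=> [|_ _ [c ->] [d ->]|c _ [d ->]|b a _ [c ->]].
- by exists (fun=> 0); rewrite big1 // => l _; rewrite mul0r.
- exists (fun l => c l + d l); rewrite -big_split.
  by apply: eq_bigr => l _; rewrite mulrDl.
- exists (fun l => c * d l); rewrite mulr_sumr.
  by apply: eq_bigr => l _; rewrite mulrA.
- exists (fun l => hpart b (mdeg (e l) + a) (c l)); rewrite raddf_sum.
  apply: eq_bigr => l _; apply: hpartM.
  by rewrite -['X_[_]]scale1r; apply: shift_homogZX.
Qed.

Definition faces i : {set {set 'I_n}} := [set S : {set 'I_n} | #|S| == i].

(** A sum of at most one term: [l] can only be the element of [S] outside [T]. *)
Definition taylor_coef S T : R := \sum_(l | (l \notin T) && (S == l |: T))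
  (-1) ^+ pos l (l |: T) *: 'X_[lcm_mon e (l |: T) - lcm_mon e T].

Definition taylor : graded_free_seq k m :=
  @GradedFreeSeq k m (fun i => #|faces i|)
    (fun i s => mdeg (lcm_mon e (enum_val s)))
    (fun i => \matrix_(s, t) taylor_coef (enum_val s) (enum_val t))
    (const_mx 1).

(** Extension by zero to subsets of every cardinality, so that [tmap] applies. *)
Definition of_row i (u : 'rV[R]_#|faces i|) S : R :=
  \sum_(s | enum_val s == S) u 0 s.

Definition to_row i f : 'rV[R]_#|faces i| := \row_s f (enum_val s).

Lemma of_row_enum_val i (u : 'rV[R]_#|faces i|) s :
  of_row u (enum_val s) = u 0 s.
Proof.
by rewrite /of_row (big_pred1 s) // => t; rewrite (inj_eq enum_val_inj).
Qed.

Lemma of_row_card i (u : 'rV[R]_#|faces i|) S : #|S| != i -> of_row u S = 0.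
Proof.
move=> cardS; rewrite /of_row big1 // => s /eqP eqS.
by have := enum_valP s; rewrite eqS inE (negPf cardS).
Qed.

Lemma to_rowK i f S : #|S| = i -> of_row (to_row i f) S = f S.
Proof.
move=> cardS; have SI : S \in faces i by rewrite inE cardS.
by rewrite -(enum_rankK_in SI SI) of_row_enum_val mxE.
Qed.

Lemma mul_taylor_diff i (u : 'rV[R]_(rk taylor i.+1)) t :
  (u *m diff taylor i) 0 t = tmap e (of_row u) (enum_val t).
Proof.
rewrite mxE /tmap; set T := enum_val t.
under eq_bigr => s _ do rewrite mxE mulr_sumr big_mkcondr /=.
rewrite exchange_big /=; apply: eq_bigr => l _.
rewrite mulr_suml scaler_sumr [RHS]big_mkcond; apply: eq_bigr => s _.
by case: ifP => // _; rewrite scalerAr.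
Qed.

Lemma taylor_diff_eq i (u : 'rV[R]_(rk taylor i)) (w : 'rV_(rk taylor i.+1)) :
  (forall T, #|T| = i -> tmap e (of_row w) T = of_row u T) ->
  u = w *m diff taylor i.
Proof.
move=> eq_uw; apply/rowP => t; rewrite mul_taylor_diff eq_uw.
  by rewrite of_row_enum_val.
by apply/eqP; have := enum_valP t; rewrite inE.
Qed.

Lemma eq_tmap f g T : (forall S, #|S| = #|T|.+1 -> f S = g S) ->
  tmap e f T = tmap e g T.
Proof.
by move=> eq_fg; apply: eq_bigr => l lT; rewrite eq_fg // cardsU1 lT.
Qed.

Lemma taylor_lift i (u : 'rV[R]_(rk taylor i)) g :
  (forall T, tmap e g T = of_row u T) ->
  exists w, u = w *m diff taylor i.
Proof.
move=> eq_g; exists (to_row i.+1 g); apply: taylor_diff_eq => T cardT.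
by rewrite -eq_g; apply: eq_tmap => S; rewrite cardT => /to_rowK ->.
Qed.

Lemma mul_taylor_aug (u : 'rV[R]_(rk taylor 0)) :
  (u *m aug taylor) 0 0 = of_row u set0.
Proof.
rewrite mxE /of_row; apply: eq_big => [s|s _]; last by rewrite mxE mulr1.
by have := enum_valP s; rewrite inE cards_eq0 => ->.
Qed.

Lemma tmap_set0_ideal g : monomial_ideal (tmap e g set0).
Proof.
exists (fun l => (-1) ^+ pos l (l |: set0) *: g (l |: set0)).
rewrite /tmap; apply: eq_big => [l|l _]; first by rewrite inE.
by rewrite -scalerAl setU0 lcm_mon0 lcm_mon1 subm0.
Qed.

(** For the converse, [p] placed on the empty face is a cycle to which [tmap_exact] applies, and a
    preimage expresses [p] by the generators. *)
Lemma monomial_idealP p :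
  monomial_ideal p <-> forall w, (forall l, ~~ (e l <= w)%MM) -> p@_w = 0.
Proof.
split=> [[c ->] w no_e|p0].
  rewrite raddf_sum big1 // => l _.
  by rewrite /= mcoeffMX_le (negPf (no_e l)).
pose f S : R := if S == set0 then p else 0.
have [T|w no_e|g gP] := @tmap_exact k m n e f.
- rewrite /tmap big1 // => l lT; rewrite /f -cards_eq0 cardsU1 lT.
  by rewrite /= mul0r scaler0.
- by rewrite /f eqxx p0.
have -> : p = f set0 by rewrite /f eqxx.
by rewrite -gP; apply: tmap_set0_ideal.
Qed.

Lemma taylor_resolves : resolves monomial_ideal taylor.
Proof.
split.
- split=> [i s t|t mon].
    rewrite mxE; apply/shift_homogP; rewrite raddf_sum.
    apply: eq_bigr => l /andP[_ /eqP eqS]; apply/shift_homogP/shift_homogZX.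
    by rewrite /= -mdegD submK ?eqS // lcm_mon_sub ?subsetUr.
  rewrite mxE mcoeff_msupp mcoeff1; case: (mon =P _) => [->|_];
    last by rewrite eqxx.
  move=> _; rewrite /= mdeg0.
  have := enum_valP t; rewrite inE cards_eq0 => /eqP ->.
  by rewrite lcm_mon0 mdeg0.
- move=> i u; split=> [u0|[w ->]].
    (* [u] lives on nonempty faces, so its value at the empty face is 0 and the second hypothesis is
       trivial. *)
    have [T|w _|g /taylor_lift //] := @tmap_exact k m n e (of_row u).
      have [cardT|cardT] := eqVneq #|T| i.
        have TI : T \in faces i by rewrite inE cardT.
        by rewrite -(enum_rankK_in TI TI) -mul_taylor_diff u0 mxE.
      rewrite /tmap big1 // => l lT; rewrite of_row_card ?mul0r ?scaler0 //.
      by rewrite cardsU1 lT eqSS.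
    by rewrite of_row_card ?mcoeff0 // cards0.
  apply/rowP => t.
  rewrite mul_taylor_diff mxE -[RHS](tmap_tmap e (of_row w) (enum_val t)).
  apply: eq_tmap => S; have := enum_valP t; rewrite inE => /eqP -> cardS.
  have SI : S \in faces i.+1 by rewrite inE cardS.
  by rewrite -(enum_rankK_in SI SI) of_row_enum_val mul_taylor_diff.
- move=> u; rewrite mul_taylor_aug; split=> [/monomial_idealP u0|[w ->]].
    (* Here the second hypothesis is exactly membership in the ideal. *)
    have [T|w no_e|g /taylor_lift //] := @tmap_exact k m n e (of_row u).
      rewrite /tmap big1 // => l lT; rewrite of_row_card ?mul0r ?scaler0 //.
      by rewrite cardsU1 lT.
    exact: u0.
  have S0 : set0 \in faces 0 by rewrite inE cards0.
  rewrite -(enum_rankK_in S0 S0) of_row_enum_val mul_taylor_diff.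
  by rewrite enum_rankK_in //; apply: tmap_set0_ideal.
- move=> p; exists (to_row 0 (fun=> p)).
  rewrite mul_taylor_aug to_rowK ?cards0 // subrr.
  by case: homog_monomial_ideal.
Qed.

Lemma rank_diag_pred (K : fieldType) p (P : pred 'I_p) :
  \rank (diag_mx (\row_s (P s)%:R : 'rV[K]_p)) = #|P|.
Proof.
have -> : \rank (diag_mx (\row_s (P s)%:R : 'rV[K]_p))
    = \rank (\sum_(s | P s) <<delta_mx 0 s : 'rV[K]_p>>)%MS.
  apply: eqmx_rank; apply/andP; split.
    apply/row_subP => s; rewrite row_diag_mx mxE.
    have [Ps|_] := boolP (P s); last by rewrite scale0r sub0mx.
    by rewrite scale1r (sumsmx_sup s) ?genmxE.
  apply/sumsmx_subP => s Ps; rewrite genmxE.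
  have <- : row s (diag_mx (\row_s (P s)%:R)) = delta_mx 0 s :> 'rV[K]_p.
    by rewrite row_diag_mx mxE Ps scale1r.
  exact: row_sub.
have /mxdirectP -> /= :
    mxdirect (\sum_(s | P s) <<delta_mx 0 s : 'rV[K]_p>>)%MS.
  by apply: mxdirect_delta => s t _ _.
rewrite -sum1_card; apply: eq_bigr => s _.
by rewrite genmxE mxrank_delta.
Qed.

Lemma homology_dim_taylor i j :
  (forall l S, l \notin S -> lcm_mon e (l |: S) <> lcm_mon e S) ->
  homology_dim taylor i.+1 j =
    #|[set S : {set 'I_n} | (#|S| == i.+1) && (mdeg (lcm_mon e S) == j)]|.
Proof.
move=> lcm_neq.
(* Every quotient of lcms is a nontrivial monomial, so no entry has a constant term. *)
have diff0 r : diff_k taylor r = 0.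
  apply/matrixP => s t; rewrite !mxE raddf_sum big1 // => l /andP[lT _].
  rewrite /= mcoeffZ mcoeffX; case: eqP => [eq0|_]; last by rewrite mulr0.
  case: (lcm_neq _ _ lT).
  by rewrite -[LHS](submK (lcm_mon_sub e (subsetUr [set l] _))) eq0 add0m.
rewrite /homology_dim /= /boundaries_k !diff0 mulmx0 mxrank0 subn0.
have cap_ker0 p q r (A : 'M[k]_(p, q)) :
    \rank (A :&: kermx (0 : 'M_(q, r)))%MS = \rank A.
  apply: eqmx_rank; rewrite capmxSl sub_capmx submx_refl /=.
  by apply/sub_kermxP; rewrite mulmx0.
rewrite cap_ker0 rank_diag_pred.
have -> : [set S : {set 'I_n} | (#|S| == i.+1) && (mdeg (lcm_mon e S) == j)]
    = [set S in faces i.+1 | mdeg (lcm_mon e S) == j].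
  by apply/setP => S; rewrite !inE.
transitivity (\sum_(S in faces i.+1 | mdeg (lcm_mon e S) == j) 1)%N.
  by rewrite -sum1_card big_enum_val_cond.
by rewrite sum1dep_card; apply: eq_card => S; rewrite !inE.
Qed.

Lemma betti_monomial_ideal i j :
  (forall l S, l \notin S -> lcm_mon e (l |: S) <> lcm_mon e S) ->
  betti monomial_ideal i.+1 j =
    #|[set S : {set 'I_n} | (#|S| == i.+1) && (mdeg (lcm_mon e S) == j)]|.
Proof.
move=> /homology_dim_taylor <-.
exact: betti_resolves homog_monomial_ideal _ _ _ taylor_resolves.
Qed.

End TaylorResolution.

(** * Circular runs *)

Section Words.
Local Open Scope nat_scope.

(** [b] is the letter before [w]. A fall ends a run of true; a run reaching the end of [w] is not
    counted. *)
Fixpoint falls (b : bool) (w : bitseq) : nat :=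
  if w is c :: w' then (b && ~~ c) + falls c w' else 0.

Lemma falls_sum b w n : size w = n ->
  falls b w = \sum_(l < n) (nth false (b :: w) l && ~~ nth false w l).
Proof.
move=> <-; elim: w b => [|c w IHw] b /=; first by rewrite big_ord0.
by rewrite IHw big_ord_recl.
Qed.

Lemma card_tuple_cons n (Q : pred bitseq) :
  #|[set t : n.+1.-tuple bool | Q t]| =
    #|[set t : n.-tuple bool | Q (true :: t)]|
      + #|[set t : n.-tuple bool | Q (false :: t)]|.
Proof.
pose c b (t : n.-tuple bool) := [tuple of b :: t].
have c_inj b : injective (c b) by move=> t u /(congr1 val) [] /val_inj.
rewrite -(card_imset _ (c_inj true)) -(card_imset _ (c_inj false)).
rewrite -cardsUI [X in _ = _ + #|pred_of_set X|](_ : _ = set0) ?cards0 ?addn0.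
  apply: eq_card => t; rewrite !inE; apply/idP/orP => [Qt|[]].
  - case/tupleP: t Qt => -[] t Qt; [left|right]; apply/imsetP; exists t;
      by rewrite ?inE //; apply: val_inj.
  - by case/imsetP => u; rewrite inE => Qu ->.
  - by case/imsetP => u; rewrite inE => Qu ->.
apply/setP => t; rewrite !inE; apply/negbTE/andP => -[] /imsetP[u _ ->].
by case/imsetP => v _ /(congr1 val).
Qed.

(** As the last letter is true, its run is the one that [falls] misses: for [b = false] there are
    [r.+1] runs of true. *)
Definition words (b : bool) n i r :=
  #|[set t : n.-tuple bool | [&& count id t == i, falls b t == r & last b t]]|.

(* The number of ways to write [z] as an ordered sum of [r] positive terms. *)
Definition compositions z r :=
  match z, r with
  | 0, 0 => 1
  | z.+1, r.+1 => 'C(z, r)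
  | _, _ => 0
  end.

Lemma wordsS b n i r :
  words b n.+1 i r = (if i is i'.+1 then words true n i' r else 0) +
    (if b then if r is r'.+1 then words false n i r' else 0
     else words false n i r).
Proof.
rewrite /words (card_tuple_cons _ (fun t : bitseq =>
  [&& count id t == i, falls b t == r & last b t])).
congr (_ + _).
  case: i => [|i]; last by apply: eq_card => t; rewrite !inE /= andbF.
  by apply/eqP; rewrite cards_eq0; apply/eqP/setP => t; rewrite !inE.
case: b => /=; last by apply: eq_card => t; rewrite !inE.
case: r => [|r]; last by apply: eq_card => t; rewrite !inE.
by apply/eqP; rewrite cards_eq0; apply/eqP/setP => t; rewrite !inE andbF.
Qed.

(** After true come [r] nonempty blocks of false and [r.+1] blocks of true, the first of them
    possibly empty as it continues [b]. After false both letters have [r.+1] blocks, and only the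
    first block of false may be empty. The proof is Pascal's rule, by induction through the first
    letter. *)
Lemma words_card n i r :
  (words true n i r =
     if i <= n then compositions (n - i) r * 'C(i, r) else 0) /\
  (words false n i r =
     if i <= n then 'C(n - i, r) * compositions i r.+1 else 0).
Proof.
elim: n i r => [|n IHn] i r.
  have words0 b : words b 0 i r = [&& i == 0, r == 0 & b].
    rewrite /words.
    case: (boolP [&& _, _ & _]) => [/and3P[/eqP -> /eqP -> ->]|no].
      rewrite [X in #|pred_of_set X|](_ : _ = [set [tuple]]) ?cards1 //.
      by apply/setP => t; rewrite !inE tuple0.
    apply/eqP; rewrite cards_eq0; apply/eqP/setP => t; rewrite !inE tuple0 /=.
    by rewrite [0 == i]eq_sym [0 == r]eq_sym (negPf no).
  by rewrite !words0; case: i r words0 => [|i] [|r] _; rewrite /= ?andbF ?muln0.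
rewrite !wordsS; case: i => [|i].
  have [_ ->] := IHn 0 r; split.
    by case: r => [|r]; rewrite // (IHn 0 r).2 !muln0.
  by rewrite !muln0.
rewrite (IHn i r).1 (IHn i.+1 r).2 ltnS.
case: (ltngtP i n) => [i_n|i_n|->].
- rewrite subSS -(subnSK i_n) /=; set z := n - i.+1.
  case: r => [|r] /=; first by rewrite !bin0.
  rewrite (IHn i.+1 r).2 i_n -/z /= !binS; lia.
- by split=> //; case: r => [|r] //; rewrite (IHn i.+1 r).2 ltnNge ltnW.
- rewrite !subnn; case: r => [|r] /=; first by rewrite !bin0.
  by rewrite (IHn n.+1 r).2 ltnn.
Qed.

End Words.

Section CircularRuns.
Local Open Scope nat_scope.

Lemma ordS_ind n (P : 'I_n -> Prop) a :
  P a -> (forall l, P l -> P (ordS l)) -> forall l, P l.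
Proof.
move=> Pa PS l.
have iterE j : val (iter j (@ordS n) a) = (a + j) %% n.
  elim: j => [|j IHj]; first by rewrite addn0 modn_small.
  by rewrite iterS /= IHj -addn1 modnDml addn1 addnS.
(* From [a], [n - a] steps lead round to 0 modulo [n], and [l] more lead to [l]. *)
suff <- : iter (l + (n - a)) (@ordS n) a = l.
  by elim: (_ + _) => //= j; apply: PS.
apply: val_inj; rewrite iterE addnCA subnKC ?modnDr ?modn_small //.
exact: ltnW.
Qed.

Lemma ordS_closed n (A : {set 'I_n}) :
  A != set0 -> (forall l, l \in A -> ordS l \in A) -> A = setT.
Proof.
case/set0Pn => a aA clA; apply/setP => l; rewrite inE.
by apply: (ordS_ind (P := fun l => l \in A) aA).
Qed.

(* The maximal circular runs of [S], counted by their last elements. *)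
Definition runs n (S : {set 'I_n}) : nat := #|[set l in S | ordS l \notin S]|.

Lemma runs_gt0 n (S : {set 'I_n}) : S != set0 -> S != setT -> 0 < runs S.
Proof.
move=> S0; apply: contraR; rewrite -eqn0Ngt cards_eq0 => /eqP no_end.
apply/eqP/ordS_closed => // l lS; move/setP/(_ l): no_end.
by rewrite !inE lS /= => /negbFE.
Qed.

Lemma runs_le n (S : {set 'I_n}) : runs S <= #|S|.
Proof. by apply/subset_leq_card/subsetP => l; rewrite inE => /andP[]. Qed.

Lemma mem_ordS_imset n (S : {set 'I_n}) l :
  (ordS l \in [set ordS x | x in S]) = (l \in S).
Proof. exact/mem_imset/ordS_inj. Qed.

Lemma runs_ordS n (S : {set 'I_n}) : runs [set ordS l | l in S] = runs S.
Proof.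
rewrite /runs -(card_imset [set l in S | _] (@ordS_inj n)); apply: eq_card => l.
rewrite -[l]ord_predK [RHS]mem_imset; last exact: ordS_inj.
by rewrite !inE !mem_ordS_imset.
Qed.

(** Rotation by [ordS] preserves size and runs and moves the end of a run from [l] to [ordS l], so
    each position is an end for equally many sets. *)
Lemma runs_count n i r :
  r * #|[set S : {set 'I_n.+1} | (#|S| == i) && (runs S == r)]|
    = n.+1 * #|[set S : {set 'I_n.+1} | [&& #|S| == i, runs S == r,
                  ord_max \in S & ord0 \notin S]]|.
Proof.
pose ends (l : 'I_n.+1) := #|[set S : {set 'I_n.+1} |
  [&& #|S| == i, runs S == r, l \in S & ordS l \notin S]]|.
have endsS l : ends (ordS l) = ends l.
  have imset_inj : injective (fun S : {set 'I_n.+1} => [set ordS l | l in S]).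
    by apply: imset_inj; apply: ordS_inj.
  rewrite /ends -[RHS](card_imset _ imset_inj); apply: eq_card => S.
  have [T ->] : exists T : {set 'I_n.+1}, S = [set ordS l | l in T].
    exists [set l | ordS l \in S]; apply/setP => x.
    by rewrite -[x]ord_predK mem_ordS_imset inE.
  rewrite mem_imset // !inE (card_imset _ (@ordS_inj _)) runs_ordS.
  by rewrite !mem_ordS_imset.
have ends_max l : ends l = ends ord_max.
  apply: (ordS_ind (P := fun l => ends l = ends ord_max) (erefl _)) l.
  by move=> l <-.
have ordS_max : ordS (ord_max : 'I_n.+1) = ord0.
  by apply: val_inj; rewrite /= modnn.
rewrite -ordS_max -/(ends ord_max).
transitivity (\sum_(l : 'I_n.+1) ends l); last first.
  by rewrite (eq_bigr (fun=> ends ord_max)) // sum_nat_const card_ord.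
under [RHS]eq_bigr => l _ do rewrite /ends -sum1dep_card big_mkcond.
rewrite exchange_big /= -sum1dep_card big_distrr [LHS]big_mkcond /=.
apply: eq_bigr => S _; rewrite muln1.
case: andP => [[/eqP -> /eqP eq_r]|no].
  rewrite -[LHS]eq_r [LHS]/runs -sum1dep_card [LHS]big_mkcond.
  by apply: eq_bigr => l _; rewrite eqxx eq_r eqxx.
rewrite big1 // => l _; case: and4P => // -[cardS runsS _ _].
by case: no.
Qed.

Lemma rooted_runs_count n i r : 0 < i <= n -> 0 < r ->
  #|[set S : {set 'I_n.+1} | [&& #|S| == i, runs S == r,
                  ord_max \in S & ord0 \notin S]]|
    = 'C(i.-1, r.-1) * 'C(n - i, r.-1).
Proof.
case: i r => // i [|r] // /andP[_ i_n] _.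
pose F (t : n.+1.-tuple bool) : {set 'I_n.+1} := [set l | tnth t l].
have F_inj : injective F.
  move=> t u /setP eqF; apply: eq_from_tnth => l.
  by have := eqF l; rewrite !inE.
have F_bij : bijective F.
  exists (fun S : {set 'I_n.+1} => [tuple l \in S | l < n.+1]) => [t|S].
    by apply: eq_from_tnth => l; rewrite tnth_mktuple inE.
  by apply/setP => l; rewrite inE tnth_mktuple.
(* After the case split, [i] and [r] are one less than in the statement. The last run ends at the
   cut and is no fall, so [r.+1] runs give [r] falls. *)
pose Q (w : bitseq) := [&& count id w == i.+1, falls false (behead w) == r,
  last false w & ~~ head false w].
transitivity #|[set t : n.+1.-tuple bool | Q t]|; last first.
  rewrite card_tuple_cons.
  rewrite [X in #|pred_of_set X| + _](_ : _ = set0) ?cards0 ?add0n.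
    transitivity (words false n i.+1 r).
      by apply: eq_card => t; rewrite !inE /Q /= andbT.
    by rewrite (words_card n i.+1 r).2 i_n mulnC.
  by apply/setP => t; rewrite !inE /Q /= !andbF.
rewrite -(on_card_preimset (onW_bij _ F_bij)).
apply: eq_card => t; rewrite !inE.
have cardF : #|F t| = count id t.
  rewrite -sum1_card -sum1_count big_tuple big_mkcond [RHS]big_mkcond.
  by apply: eq_bigr => l _; rewrite inE.
have nth_t (l : 'I_n.+1) : tnth t l = nth false t l by rewrite (tnth_nth false).
rewrite cardF /Q; case/tupleP: t nth_t {cardF} => b t nth_t /=.
have nth_max : nth false (b :: t) n = last b t.
  by rewrite -[RHS]/(last false (b :: t)) -nth_last /= size_tuple.
rewrite !nth_t /= nth_max.
case: b nth_t nth_max => nth_t nth_max; first by rewrite !andbF.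
rewrite !andbT; congr (_ && _); rewrite andbC [RHS]andbC.
case: (boolP (last _ _)) => //= last_t.
rewrite /runs -sum1dep_card big_mkcond big_ord_recr /= !inE.
have -> : ordS (ord_max : 'I_n.+1) = ord0 by apply: val_inj; rewrite /= modnn.
rewrite !nth_t /= nth_max last_t addn1 eqSS (falls_sum false (size_tuple t)).
congr (_ == _); apply: eq_bigr => l _.
have -> : ordS (widen_ord (leqnSn n) l) = lift ord0 l.
  by apply: val_inj; rewrite /= modn_small // ltnS.
by rewrite !inE !nth_t /=; case: (_ && _).
Qed.

End CircularRuns.

(** * Unions of edges of a hypercycle *)

Section CyclicFamily.
Local Open Scope nat_scope.

Variables (V : finType) (n d alpha : nat) (E : 'I_n -> {set V}).
Hypotheses (card_E : forall l, #|E l| = d)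
  (card_adj : forall l, #|E l :&: E (ordS l)| = alpha)
  (disj : forall l l', l != l' -> l' != ordS l -> l != ordS l' ->
     E l :&: E l' = set0).

Lemma card_bigcup_cyclic (S : {set 'I_n}) : S != setT ->
  #|\bigcup_(l in S) E l| + alpha * (#|S| - runs S) = #|S| * d.
Proof.
move=> ST.
(* Charge each vertex of the union to the last edge containing it in its run. *)
pose G l := if l \in S then E l :\: (if ordS l \in S then E (ordS l) else set0)
  else set0.
have -> : \bigcup_(l in S) E l = \bigcup_l G l.
  apply/setP => v; apply/bigcupP/bigcupP => -[l]; last first.
    by rewrite /G; case: ifP => lS _; rewrite ?inE // => /andP[_ vl]; exists l.
  move=> lS vl; have [|noG] := boolP [exists l, v \in G l].
    by move=> /existsP[x]; exists x.
  (* A vertex never charged passes from each edge of [S] containing it to the next edge, again in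
     [S]. Going round the cycle forces [S = setT]. *)
  case/eqP: ST; apply/setP => x; rewrite inE.
  suff -> : S = setT by rewrite inE.
  suff eqT : [set l in S | v \in E l] = setT.
    by apply/setP => y; move/setP/(_ y): eqT; rewrite !inE => /andP[].
  apply: ordS_closed => [|y]; first by apply/set0Pn; exists l; rewrite inE lS.
  rewrite !inE => /andP[yS vy].
  move/existsPn/(_ y): noG; rewrite /G yS inE vy andbT negbK.
  by case: ifP; rewrite ?inE.
have disjG l l' : l != l' -> [disjoint G l & G l'].
  move=> neq; rewrite -setI_eq0; apply/eqP/setP => v; rewrite !inE.
  apply/negbTE/andP; rewrite /G.
  have [lS|_] := boolP (l \in S); last by rewrite inE => -[].
  have [l'S|_] := boolP (l' \in S); last by rewrite !inE => -[].
  rewrite !in_setD => -[/andP[nvl vl] /andP[nvl' vl']].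
  have [eq1|neq1] := eqVneq l' (ordS l).
    by move: nvl; rewrite -eq1 ifT ?vl'.
  have [eq2|neq2] := eqVneq l (ordS l').
    by move: nvl'; rewrite -eq2 ifT ?vl.
  by move/setP/(_ v): (disj neq neq1 neq2); rewrite !inE vl vl'.
rewrite -sum1_card (partition_disjoint_bigcup _ _ disjG) /=.
(* These are the consecutive pairs in [S], each costing [alpha] vertices. *)
have -> : #|S| - runs S = #|[set l in S | ordS l \in S]|.
  rewrite -(cardsID [set l | ordS l \in S] S) /runs.
  rewrite (_ : [set l in S | ordS l \notin S] = S :\: [set l | ordS l \in S]).
    by rewrite addnK; apply: eq_card => l; rewrite !inE.
  by apply/setP => l; rewrite !inE andbC.
rewrite mulnC -sum_nat_const -[#|S| * d]sum_nat_const [X in _ + X]big_mkcond.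
rewrite [RHS]big_mkcond -big_split; apply: eq_bigr => l _.
rewrite sum1_card /= inE /G.
case: ifP => lS; last by rewrite cards0.
case: ifP => l'S; last by rewrite setD0 card_E addn0.
by rewrite -[in RHS](card_E l) -(cardsID (E (ordS l)) (E l)) card_adj addnC.
Qed.

(** Only the two neighbours meet [E l], and they cover at most [2 * alpha] of its [d] vertices. *)
Lemma private_vertex l : 2 * alpha < d ->
  exists2 v, v \in E l & forall l', l' != l -> v \notin E l'.
Proof.
move=> hd; pose A := E (ordS l) :|: E (ord_pred l).
have [E0|[v]] := set_0Vmem (E l :\: A).
  have := cardsID A (E l); rewrite E0 cards0 addn0 card_E => card_d.
  have [+ _] := leq_card_setU (E l :&: E (ordS l)) (E l :&: E (ord_pred l)).
  have := card_adj (ord_pred l); rewrite ord_predK setIC => ->.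
  rewrite -setIUr -/A card_d card_adj; lia.
rewrite !inE negb_or => /andP[/andP[v1 v2] vl]; exists v => // l' neq.
apply/negP => vl'.
suff /setP/(_ v) : E l :&: E l' = set0 by rewrite !inE vl vl'.
apply: disj; first by rewrite eq_sym.
  by apply: contraNneq v1 => <-.
by apply: contraNneq v2 => ->; rewrite ordSK.
Qed.

End CyclicFamily.

Lemma card_runs n i r : (0 < i < n)%N -> (0 < r)%N ->
  (r * #|[set S : {set 'I_n} | (#|S| == i) && (runs S == r)]|
    = n * ('C(i - 1, r - 1) * 'C(n - i - 1, r - 1)))%N.
Proof.
case: n => [|n] /andP[i0 i_n] r0; first by lia.
rewrite runs_count rooted_runs_count ?i0 // !subn1.
by rewrite (_ : (n.+1 - i).-1 = n - i)%N //; lia.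
Qed.

(** * Edge ideals as monomial ideals *)

Section SquarefreeMonomials.

Variables (k : fieldType) (V : finType) (n : nat) (E : 'I_n -> {set V}).

Definition set_mon (A : {set V}) : 'X_{1..#|V|} :=
  [multinom (enum_val v \in A : nat) | v < #|V|].

Lemma lcm_set_mon S : lcm_mon (set_mon \o E) S = set_mon (\bigcup_(l in S) E l).
Proof.
apply/mnmP => v; rewrite !mnmE; under eq_bigr => l _ do rewrite mnmE.
have [/bigcupP[l lS vl]|/negP no_l] := boolP (_ \in _).
  apply/eqP; rewrite eqn_leq; apply/andP; split.
    by apply/bigmax_leqP => x _; case: (_ \in _).
  by rewrite (bigmax_sup l) // vl.
rewrite big1 // => l lS; case: (boolP (_ \in _)) => // vl.
by case: no_l; apply/bigcupP; exists l.
Qed.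

Lemma mdeg_set_mon A : mdeg (set_mon A) = #|A|.
Proof.
rewrite mdegE; transitivity (\sum_(x in V) (x \in A : nat))%N.
  by rewrite [RHS]big_enum_val; apply: eq_bigr => v _; rewrite mnmE.
rewrite -sum1_card [RHS]big_mkcond; apply: eq_bigr => x _.
by case: (_ \in _).
Qed.

Lemma prod_vars_set_mon (A : {set V}) :
  \prod_(v in A) 'X_(enum_rank v) = 'X_[set_mon A] :> {mpoly k[#|V|]}.
Proof.
rewrite mprodXE; congr 'X_[_]; apply/mnmP => v; rewrite mnm_sumE mnmE.
under eq_bigr => x _ do rewrite mnm1E.
rewrite big_mkcond (bigD1 (enum_val v)) //= enum_valK eqxx big1 ?addn0 //.
move=> x neq; case: ifP => // _; case: eqP => // eq_v.
by rewrite -eq_v enum_rankK eqxx in neq.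
Qed.

End SquarefreeMonomials.

(** An equality of predicates is what permits rewriting inside [betti]; hence the extensionality
    axioms. *)
Lemma edge_ideal_monomial (k : fieldType) (H : hypergraph) n
    (E : 'I_n -> {set vertices H}) :
  injective E -> edges H = [set E i | i : 'I_n] ->
  @edge_ideal k H = monomial_ideal (fun l => set_mon (E l)).
Proof.
move=> injE eqE; apply: functional_extensionality => p.
have sumE (F : {set vertices H} -> edge_ring k H) :
    \sum_(A in edges H) F A = \sum_l F (E l).
  by rewrite eqE big_imset // => x y _ _; apply: injE.
apply: propositional_extensionality; split=> -[c ->].
  exists (fun l => c (E l)); rewrite sumE; apply: eq_bigr => l _.
  by rewrite /edge_monomial prod_vars_set_mon.
exists (fun A => \sum_(l | E l == A) c l); rewrite sumE; apply: eq_bigr => l _.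
rewrite /edge_monomial prod_vars_set_mon (big_pred1 l) // => x.
exact: inj_eq.
Qed.

Theorem theorem3p11 (k : fieldType) (n d alpha : nat) (C : hypergraph)
    (hC : hypercycle n d alpha C) (hd : (2 * alpha < d)%N)
    (i : nat) (hi : (1 <= i < n)%N) :
  (forall r : nat, (1 <= r <= i)%N ->
     (betti (@edge_ideal k C) i (i * d - alpha * (i - r)))%:R =
       n%:R / r%:R * 'C(i - 1, r - 1)%:R * 'C(n - i - 1, r - 1)%:R :> rat) /\
  (forall j : nat,
     (forall r : nat, (1 <= r <= i)%N -> j <> (i * d - alpha * (i - r))%N) ->
     betti (@edge_ideal k C) i j = 0%N).
Proof.
have /andP[i_gt0 i_n] := hi.
have [unif [E [injE eqE _ meetE [adjE wrapE]]]] := hC.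
have card_E l : #|E l| = d by apply: unif; rewrite eqE imset_f.
have succE (l l' : 'I_n) : (l' = l.+1 %[mod n])%N <-> l' = ordS l.
  split=> [eq_l|->]; last by rewrite /= modn_mod.
  by apply: val_inj; rewrite /= -eq_l modn_small.
have n_gt1 : (1 < n)%N by lia.
have ordS_neq (l : 'I_n) : l != ordS l.
  apply/eqP => /(congr1 val) /=.
  have := ltn_ord l; rewrite leq_eqVlt => /predU1P[eq_n|lt_n].
    by rewrite eq_n modnn; lia.
  by rewrite modn_small //; lia.
have card_adj (l : 'I_n) : #|E l :&: E (ordS l)| = alpha.
  have := ltn_ord l; rewrite leq_eqVlt => /predU1P[eq_n|lt_n].
    rewrite setIC; apply: wrapE; first by rewrite /= eq_n modnn.
    exact: (congr1 predn eq_n).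
  by apply: adjE; rewrite /= modn_small.
have disj l l' : l != l' -> l' != ordS l -> l != ordS l' -> E l :&: E l' = set0.
  move=> neq neq1 neq2; apply/eqP; apply: contraT => /(meetE _ _ neq) [] eq_l.
    by move/succE/esym: (esym eq_l) neq2 => ->; rewrite eqxx.
  by move/succE: eq_l neq1 => ->; rewrite eqxx.
(* Consecutive edges meet by [meetE]. Positivity is what separates the degrees belonging to
   different numbers of runs. *)
have alpha_gt0 : (0 < alpha)%N.
  pose l0 := Ordinal (ltnW n_gt1).
  rewrite -(card_adj l0) card_gt0; apply/(meetE _ _ (ordS_neq l0)); right.
  exact/succE.
pose e l := set_mon (E l).
have lcm_neq (l : 'I_n) (S : {set 'I_n}) :
    l \notin S -> lcm_mon e (l |: S) <> lcm_mon e S.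
  move=> lS; have [v vl v_priv] := private_vertex card_E card_adj disj l hd.
  move/mnmP/(_ (enum_rank v)); rewrite !lcm_set_mon !mnmE !enum_rankK.
  have -> : v \in \bigcup_(x in l |: S) E x.
    by apply/bigcupP; exists l; rewrite ?setU11.
  have [/bigcupP[x xS vx]|//] := boolP (v \in \bigcup_(x in S) E x).
  suff /negP[] : v \notin E x by [].
  by apply: v_priv; apply: contraNneq lS => <-.
have bettiE j : betti (@edge_ideal k C) i j =
    #|[set S : {set 'I_n} |
        (#|S| == i) && (i * d - alpha * (i - runs S) == j)%N]|.
  rewrite (edge_ideal_monomial k injE eqE) -(prednK i_gt0).
  rewrite betti_monomial_ideal //.
  apply: eq_card => S; rewrite !inE prednK //; case: eqP => //= card_S.
  have ST : S != setT.
    by apply: contraTneq i_n => ST; rewrite -card_S ST cardsT card_ord ltnn.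
  rewrite lcm_set_mon mdeg_set_mon -card_S.
  by rewrite -(card_bigcup_cyclic card_E card_adj disj ST) addnK.
split=> [r /andP[r_gt0 r_i]|j neq_j].
  rewrite bettiE.
  have -> : [set S : {set 'I_n} | (#|S| == i) &&
        (i * d - alpha * (i - runs S) == i * d - alpha * (i - r))%N]
      = [set S : {set 'I_n} | (#|S| == i) && (runs S == r)].
    apply/setP => S; rewrite !inE; case: eqP => //= card_S.
    apply/eqP/eqP => [|->] //.
    (* [2 * alpha < d] keeps both subtractions from truncating, and [alpha > 0] lets the degree
       determine the number of runs. *)
    have := runs_le S; rewrite card_S; nia.
  have r_neq0 : r%:R != 0 :> rat by rewrite Num.Theory.pnatr_eq0 -lt0n.
  apply: (mulfI r_neq0); rewrite -natrM card_runs // !mulrA.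
  by rewrite [r%:R * n%:R]mulrC mulfK // !natrM mulrA.
rewrite bettiE; apply/eqP; rewrite cards_eq0; apply/eqP/setP => S; rewrite !inE.
(* Since [0 < i < n], [S] is nonempty and proper, so [runs S] lies between 1 and [i], and [neq_j]
   excludes its degree. *)
apply/negbTE/andP => -[/eqP card_S /eqP eq_j]; case: (neq_j (runs S)) => //.
have := runs_le S; rewrite card_S => ->; rewrite andbT; apply: runs_gt0.
  by rewrite -card_gt0 card_S.
by apply: contraTneq i_n => ST; rewrite -card_S ST cardsT card_ord ltnn.
Qed.
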